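(* Let $s\ge 1$ and let $a_{ij}, b_i$ ($i,j=1,\dots,s$) be real numbers satisfying $$b_i a_{ij}+b_j a_{ji}=b_i b_j,\qquad b_i\ge 0,\qquad \forall\, i,j=1,\dots,s .$$ Then the fully discrete HSAV-RK method with these coefficients (defined in the context) is unconditionally energy stable: for every time step $\Delta t>0$, every given $\phi^n\in V_h$, $q^n\in\mathbb R$, and every $(\Phi_i,Q_i,k_i,l_i)_{i=1}^s$, $(\phi^{n+1},q^{n+1})$ produced from it by the method, $$E_h^{n+1}-E_h^n=\Delta t\sum_{i=1}^s b_i\Big(\mathcal L_h\Phi_i+\frac{Q_i g'(\Phi_i)}{\sqrt{(g(\Phi_i),1)_h+C_0}},\ \mathcal G_h\Big[\mathcal L_h\Phi_i+\frac{Q_i g'(\Phi_i)}{\sqrt{(g(\Phi_i),1)_h+C_0}}\Big]\Big)_h\le 0,$$ where $E_h^{m}=\frac12(\mathcal L_h\phi^{m},\phi^{m})_h+(q^{m})^2-C_0$ for $m=n,n+1$.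
   Context: Grid. $N_x,N_y$ are positive even integers, $\Omega=[0,L_x]\times[0,L_y]$, $h_x=L_x/N_x$, $h_y=L_y/N_y$, $x_j=jh_x$, $y_k=kh_y$, $\Omega_h=\{(x_j,y_k):0\le j\le N_x-1,\ 0\le k\le N_y-1\}$. $V_h$ is the space of real grid functions $u=\{u_{j,k}\}$ on $\Omega_h$, with discrete inner product $(u,v)_h=h_xh_y\sum_{j=0}^{N_x-1}\sum_{k=0}^{N_y-1}u_{j,k}v_{j,k}$. Operators. In the continuous gradient flow $\partial_t\phi=\mathcal G(\mathcal L\phi+g'(\phi))$ with periodic boundary conditions, $\mathcal L$ is linear and self-adjoint and $\mathcal G$ is negative semi-definite with respect to the $L^2$ inner product. $\mathcal L_h$ and $\mathcal G_h$ are the operators on $V_h$ obtained from $\mathcal L$ and $\mathcal G$ by the Fourier pseudospectral method: a derivative $\partial_x^{s_1}\partial_y^{s_2}$ is replaced by $u\mapsto\big(\sum_{m_1,m_2}(D^x_{s_1})_{j,m_1}(D^y_{s_2})_{k,m_2}u_{m_1,m_2}\big)_{j,k}$, where $(D^x_{s_1})_{j,m}=X_m^{(s_1)}(x_j)$, $(D^y_{s_2})_{k,m}=Y_m^{(s_2)}(y_k)$, with $X_j(x)=\frac1{N_x}\sum_{m=-N_x/2}^{N_x/2}\frac1{a_m}e^{\mathrm{i}m\mu_x(x-x_j)}$, $Y_k(y)=\frac1{N_y}\sum_{m=-N_y/2}^{N_y/2}\frac1{b_m}e^{\mathrm{i}m\mu_y(y-y_k)}$, $\mu_x=2\pi/L_x$,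 $\mu_y=2\pi/L_y$, $a_m=1$ for $|m|<N_x/2$ and $a_m=2$ for $|m|=N_x/2$, $b_m=1$ for $|m|<N_y/2$ and $b_m=2$ for $|m|=N_y/2$ (these $a_m,b_m$ are unrelated to the RK coefficients). The standing properties of these operators are: $\mathcal L_h$ is linear, and $$(\mathcal L_h\phi,\psi)_h=(\phi,\mathcal L_h\psi)_h,\qquad (\psi,\mathcal G_h\psi)_h\le0,\qquad\forall\,\phi,\psi\in V_h.$$ $g:\mathbb R\to\mathbb R$ is differentiable with derivative $g'$, both applied pointwise to grid functions, and $C_0>0$ is a constant with $(g(\phi),1)_h+C_0>0$ for all grid functions $\phi$ considered. Fully discrete HSAV-RK method. Let $b_i,a_{ij}$ be real and $c_i=\sum_{j=1}^s a_{ij}$. Given $\phi^n\in V_h$ and $q^n\in\mathbb R$, the intermediate values $\Phi_i,k_i\in V_h$, $Q_i,l_i\in\mathbb R$, $i=1,\dots,s$, satisfy $$\Phi_i=\phi^n+\Delta t\sum_{j=1}^s a_{ij}k_j,\qquad Q_i=q^n+\Delta t\sum_{j=1}^s a_{ij}l_j,$$ $$k_i=\mathcal G_h\Big(\mathcal L_h\Phi_i+\frac{Q_i g'(\Phi_i)}{\sqrt{(g(\Phi_i),1)_h+C_0}}\Big),\qquad l_i=\Big(\frac{g'(\Phi_i)}{2\sqrt{(g(\Phi_i),1)_h+C_0}},k_i\Big)_h,$$ and then $$\phi^{n+1}=\phi^n+\Delta t\sum_{i=1}^s b_i k_i,\qquad q^{n+1}=q^n+\Delta t\sum_{i=1}^s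 b_i l_i .$$ *)

(* Defs.v *)
From mathcomp Require Import all_boot all_order all_algebra.
From mathcomp Require Import all_classical all_reals all_analysis.
From mathcomp Require Import complex.

Set Implicit Arguments.
Unset Strict Implicit.
Unset Printing Implicit Defensive.

Import Order.TTheory GRing.Theory Num.Theory.
Import numFieldNormedType.Exports.

Local Open Scope classical_set_scope.
Local Open Scope ring_scope.
Local Open Scope complex_scope.

(* e^(i t) *)
Definition expi (R : realType) (t : R) : R[i] := cos t +i* sin t.

Definition node (R : realType) (N : nat) (L : R) (j : 'I_N) : R :=
  j%:R * (L / N%:R).

(* The weight a_m (or b_m) and the terms of the sum over -N/2 <= m <= N/2;
   the summation index is shifted so that the i-th term has m = i - N/2. *)
Definition freq (N : nat) (i : 'I_N.+1) : int := i%:Z - (N./2)%:Z.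

Definition weight (R : realType) (N : nat) (m : int) : R :=
  if `|m|%N == N./2 then 2 else 1.

Definition trig_cardinal (R : realType) (N : nat) (L : R) (j : 'I_N) (x : R)
  : R[i] :=
  (N%:R)^-1 * \sum_(i < N.+1)
    ((weight R N (freq i))^-1)%:C
      * expi ((freq i)%:~R * (2 * pi / L) * (x - node L j)).

(* The function above is real-valued, so that [diff_mx] below loses nothing in
   differentiating its real part. *)
Lemma trig_cardinal_real (R : realType) (N : nat) (L : R) (j : 'I_N) (x : R) :
  ~~ odd N -> complex.Im (trig_cardinal L j x) = 0.
Proof.
move=> evN; rewrite /trig_cardinal.
have ImM (c : R) (z : R[i]) : complex.Im (c%:C * z) = c * complex.Im z.
  by case: z => u v /=; rewrite mul0r addr0.
have -> : (N%:R : R[i])^-1 = ((N%:R : R)^-1)%:C.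
  by rewrite fmorphV rmorph_nat.
rewrite ImM (raddf_sum (@complex.Im R)).
rewrite (eq_bigr _ (fun i _ => ImM _ _)).
set S := \sum_(i < N.+1) _.
suff /eqP : S = - S.
  by rewrite -addr_eq0 -mulr2n mulrn_eq0 /= => /eqP ->; rewrite mulr0.
rewrite {1}/S (reindex_inj rev_ord_inj) /= -sumrN; apply: eq_bigr => i _.
have -> : freq (rev_ord i) = - freq i.
  have iN : (i <= N)%N by rewrite -ltnS.
  have NE : N%:Z = (N./2)%:Z + (N./2)%:Z.
    by rewrite -PoszD addnn even_halfK.
  by rewrite /freq /= subSS -(subzn iN) NE opprB addrAC addrK.
by rewrite /weight abszN rmorphN !mulNr sinN mulrN.
Qed.

(* (D_s)_{j,m} = s-th derivative of the m-th cardinal function at x_j *)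
Definition diff_mx (R : realType) (N : nat) (L : R) (s : nat) : 'M[R]_N :=
  \matrix_(j, m)
    derive1n s (fun x => complex.Re (trig_cardinal L m x)) (node L j).

(* A grid function u on Omega_h is the Nx x Ny matrix of its values. *)
Definition grid_deriv (R : realType) (Nx Ny : nat) (Lx Ly : R) (s1 s2 : nat)
    (u : 'M[R]_(Nx, Ny)) : 'M[R]_(Nx, Ny) :=
  \matrix_(j, k) \sum_(m1 < Nx) \sum_(m2 < Ny)
    diff_mx Nx Lx s1 j m1 * diff_mx Ny Ly s2 k m2 * u m1 m2.

(* Expressions for the operators of the gradient flow, in the unknown function
   u(x,y) ([Arg]).  [Pointwise f A] is f(A u), and [Deriv s1 s2 A] is
   d_x^s1 d_y^s2 (A u).  An operator is kept as an expression because its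
   pseudospectral discretization depends on how it is written: composing the
   matrices of two derivatives does not in general give that of the composed
   derivative. *)
Inductive diffop (R : realType) : Type :=
| Arg
| Func of R -> R -> R
| Pointwise of (R -> R) & diffop R
| Add of diffop R & diffop R
| Mul of diffop R & diffop R
| Deriv of nat & nat & diffop R.

Fixpoint pseudospectral (R : realType) (Nx Ny : nat) (Lx Ly : R)
    (A : diffop R) (u : 'M[R]_(Nx, Ny)) : 'M[R]_(Nx, Ny) :=
  match A with
  | Arg => u
  | Func f => \matrix_(j, k) f (node Lx j) (node Ly k)
  | Pointwise f B => map_mx f (pseudospectral Lx Ly B u)
  | Add B C => pseudospectral Lx Ly B u + pseudospectral Lx Ly C u
  | Mul B C =>
      map2_mx *%R (pseudospectral Lx Ly B u) (pseudospectral Lx Ly C u)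
  | Deriv s1 s2 B => grid_deriv Lx Ly s1 s2 (pseudospectral Lx Ly B u)
  end.

Definition dip (R : realType) (Nx Ny : nat) (Lx Ly : R)
    (u v : 'M[R]_(Nx, Ny)) : R :=
  (Lx / Nx%:R) * (Ly / Ny%:R) * \sum_(j < Nx) \sum_(k < Ny) u j k * v j k.

(* (g(u),1)_h + C0 *)
Definition sav_radicand (R : realType) (Nx Ny : nat) (Lx Ly : R) (g : R -> R)
    (C0 : R) (u : 'M[R]_(Nx, Ny)) : R :=
  dip Lx Ly (map_mx g u) (const_mx 1) + C0.

(* L_h u + q g'(u) / sqrt((g(u),1)_h + C0) *)
Definition chem_potential (R : realType) (Nx Ny : nat) (Lx Ly : R)
    (Lh : 'M[R]_(Nx, Ny) -> 'M[R]_(Nx, Ny)) (g : R -> R) (C0 : R)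
    (u : 'M[R]_(Nx, Ny)) (q : R) : 'M[R]_(Nx, Ny) :=
  Lh u + (q / Num.sqrt (sav_radicand Lx Ly g C0 u)) *: map_mx (derive1 g) u.

Record hsav_rk_step (R : realType) (Nx Ny : nat) (Lx Ly : R)
    (Lh Gh : 'M[R]_(Nx, Ny) -> 'M[R]_(Nx, Ny)) (g : R -> R) (C0 : R)
    (s : nat) (a : 'I_s -> 'I_s -> R) (b : 'I_s -> R) (dt : R)
    (phi : 'M[R]_(Nx, Ny)) (q : R)
    (Phi : 'I_s -> 'M[R]_(Nx, Ny)) (Q : 'I_s -> R)
    (k : 'I_s -> 'M[R]_(Nx, Ny)) (l : 'I_s -> R)
    (phi' : 'M[R]_(Nx, Ny)) (q' : R) : Prop := HsavRkStep {
  stage_phi : forall i, Phi i = phi + dt *: \sum_(j < s) a i j *: k j;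
  stage_q : forall i, Q i = q + dt * \sum_(j < s) a i j * l j;
  slope_phi : forall i,
    k i = Gh (chem_potential Lx Ly Lh g C0 (Phi i) (Q i));
  slope_q : forall i,
    l i = dip Lx Ly
      ((2 * Num.sqrt (sav_radicand Lx Ly g C0 (Phi i)))^-1
         *: map_mx (derive1 g) (Phi i)) (k i);
  update_phi : phi' = phi + dt *: \sum_(i < s) b i *: k i;
  update_q : q' = q + dt * \sum_(i < s) b i * l i
}.

Definition discrete_energy (R : realType) (Nx Ny : nat) (Lx Ly : R)
    (Lh : 'M[R]_(Nx, Ny) -> 'M[R]_(Nx, Ny)) (C0 : R)
    (phi : 'M[R]_(Nx, Ny)) (q : R) : R :=
  2^-1 * dip Lx Ly (Lh phi) phi + q ^+ 2 - C0.

(* Main.v *)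
(* Both summands of the energy, besides the constant, are quadratic forms in
   the unknowns (phi, q).  A Runge-Kutta method whose coefficients satisfy
   b_i a_ij + b_j a_ji = b_i b_j changes a quadratic form B(y, y) by exactly
   2 dt \sum_i b_i B(Y_i, k_i): the terms in dt^2 cancel.  For the energy
   this sum is dt \sum_i b_i (mu_i, k_i)_h, because the factor 1/2 in l_i
   makes 2 Q_i l_i the nonlinear part of (mu_i, k_i)_h; finally
   k_i = G_h mu_i and G_h is negative semi-definite. *)
Require Import Defs.
From HB Require Import structures.
From mathcomp Require Import all_boot all_order all_algebra.
From mathcomp Require Import all_classical all_reals all_analysis.
From mathcomp Require Import ring.

Set Implicit Arguments.
Unset Strict Implicit.
Unset Printing Implicit Defensive.

Import Order.TTheory GRing.Theory Num.Theory.
Import numFieldNormedType.Exports.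

Local Open Scope classical_set_scope.
Local Open Scope ring_scope.

Lemma dipC (R : realType) (Nx Ny : nat) (Lx Ly : R) (u v : 'M[R]_(Nx, Ny)) :
  dip Lx Ly u v = dip Lx Ly v u.
Proof.
by congr (_ * _); do 2!apply: eq_bigr => ? _; rewrite mulrC.
Qed.

Lemma dip_is_scalar (R : realType) (Nx Ny : nat) (Lx Ly : R)
  (u : 'M[R]_(Nx, Ny)) : scalar (dip Lx Ly u).
Proof.
move=> c v w; rewrite /dip; set h := (X in X * _).
rewrite mulrCA -mulrDr; congr (_ * _).
rewrite mulr_sumr -big_split; apply: eq_bigr => i _ /=.
rewrite mulr_sumr -big_split; apply: eq_bigr => j _ /=.
by rewrite !mxE mulrDr mulrCA.
Qed.

(** Lets [dip Lx Ly (Lh u)] be passed below as a [{scalar V}]. *)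
HB.instance Definition _ (R : realType) (Nx Ny : nat) (Lx Ly : R)
    (u : 'M[R]_(Nx, Ny)) :=
  GRing.isLinear.Build R 'M[R]_(Nx, Ny) R *%R (dip Lx Ly u)
    (dip_is_scalar Lx Ly u).

Lemma dipZl (R : realType) (Nx Ny : nat) (Lx Ly c : R)
  (u v : 'M[R]_(Nx, Ny)) : dip Lx Ly (c *: u) v = c * dip Lx Ly u v.
Proof. by rewrite dipC linearZ /= dipC. Qed.

Lemma dipDl (R : realType) (Nx Ny : nat) (Lx Ly : R)
  (u v w : 'M[R]_(Nx, Ny)) :
  dip Lx Ly (u + v) w = dip Lx Ly u w + dip Lx Ly v w.
Proof. by rewrite dipC linearD /= !(dipC _ _ w). Qed.

(** The form is abstract so that one argument serves both the grid function and the scalar auxiliary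
    variable. Linearity in the first argument comes from symmetry. *)
Lemma symplectic_rk_quadratic (R : comNzRingType) (V : lmodType R)
  (B : V -> {scalar V}) (B_sym : forall u v, B u v = B v u)
  (s : nat) (a : 'I_s -> 'I_s -> R) (b : 'I_s -> R)
  (ab_sympl : forall i j, b i * a i j + b j * a j i = b i * b j)
  (dt : R) (y : V) (Y k : 'I_s -> V)
  (YE : forall i, Y i = y + dt *: \sum_(j < s) a i j *: k j) :
  let y' := y + dt *: \sum_(i < s) b i *: k i in
  B y' y' - B y y = 2 * dt * \sum_(i < s) b i * B (Y i) (k i).
Proof.
move=> y'.
have B_comb (c : 'I_s -> R) u :
    B u (\sum_(i < s) c i *: k i) = \sum_(i < s) c i * B u (k i).
  by rewrite linear_sum; apply: eq_bigr => i _; rewrite linearZ.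
have B_Dl u v w : B (u + v) w = B u w + B v w.
  by rewrite B_sym linearD !(B_sym w).
have B_Zl c u w : B (c *: u) w = c * B u w by rewrite B_sym linearZ B_sym.
set K := \sum_(i < s) b i *: k i in y' *.
(* Averaging the double sum with its copy under the swap of i and j replaces [b i * a i j] by half
   of [b i * b j]. *)
have KE : B K K = 2 * \sum_(i < s) \sum_(j < s) b i * a i j * B (k i) (k j).
  rewrite mulr_natl mulr2n [X in _ = X + _]exchange_big -big_split /= {2}/K.
  rewrite B_comb; apply: eq_bigr => j _.
  rewrite B_sym B_comb mulr_sumr -big_split /=; apply: eq_bigr => i _.
  by rewrite (B_sym (k j)) mulrA -ab_sympl (B_sym (k i)); ring.
(* Expanding the stages leaves the same double sum, which is half of [B K K]; this matches the dt^2
   term of [B y' y']. *)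
have -> : \sum_(i < s) b i * B (Y i) (k i) =
    B y K + dt * \sum_(i < s) \sum_(j < s) b i * a i j * B (k i) (k j).
  rewrite B_comb mulr_sumr -big_split /=; apply: eq_bigr => i _.
  rewrite YE B_Dl B_Zl (B_sym (\sum_(j < s) _)) B_comb mulrDr; congr (_ + _).
  rewrite mulrCA mulr_sumr; congr (_ * _).
  by apply: eq_bigr => j _; ring.
by rewrite /y' linearD linearZ /= !B_Dl !B_Zl KE (B_sym K); ring.
Qed.

Theorem theorem4p1 (R : realType)
  (Nx Ny : nat) (Nx_gt0 : (0 < Nx)%N) (Ny_gt0 : (0 < Ny)%N)
  (Nx_even : ~~ odd Nx) (Ny_even : ~~ odd Ny)
  (Lx Ly : R) (Lx_gt0 : 0 < Lx) (Ly_gt0 : 0 < Ly)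
  (L G : diffop R) (Lh Gh : 'M[R]_(Nx, Ny) -> 'M[R]_(Nx, Ny))
  (LhE : Lh = pseudospectral Lx Ly L) (GhE : Gh = pseudospectral Lx Ly G)
  (Lh_linear : linear Lh)
  (Lh_sym : forall u v, dip Lx Ly (Lh u) v = dip Lx Ly u (Lh v))
  (Gh_nsd : forall u, dip Lx Ly u (Gh u) <= 0)
  (g : R -> R) (g_diff : forall x, derivable g x 1)
  (C0 : R) (C0_gt0 : 0 < C0)
  (s : nat) (s_ge1 : (1 <= s)%N)
  (a : 'I_s -> 'I_s -> R) (b : 'I_s -> R)
  (ab_sympl : forall i j, b i * a i j + b j * a j i = b i * b j)
  (b_ge0 : forall i, 0 <= b i)
  (dt : R) (dt_gt0 : 0 < dt)
  (phi : 'M[R]_(Nx, Ny)) (q : R)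
  (Phi : 'I_s -> 'M[R]_(Nx, Ny)) (Q : 'I_s -> R)
  (k : 'I_s -> 'M[R]_(Nx, Ny)) (l : 'I_s -> R)
  (phi' : 'M[R]_(Nx, Ny)) (q' : R)
  (radicand_gt0 : forall i, 0 < sav_radicand Lx Ly g C0 (Phi i))
  (step : hsav_rk_step Lx Ly Lh Gh g C0 a b dt phi q Phi Q k l phi' q') :
  let mu i := chem_potential Lx Ly Lh g C0 (Phi i) (Q i) in
  let dissipation := dt * \sum_(i < s) b i * dip Lx Ly (mu i) (Gh (mu i)) in
  discrete_energy Lx Ly Lh C0 phi' q' - discrete_energy Lx Ly Lh C0 phi q
    = dissipation
  /\ dissipation <= 0.
Proof.
case: step => PhiE QE kE lE phiE qE mu dissipation; split; last first.
  rewrite /dissipation pmulr_rle0 //; apply: sumr_le0 => i _.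
  exact: mulr_ge0_le0.
have LphiE := @symplectic_rk_quadratic R 'M[R]_(Nx, Ny)
  (fun u => dip Lx Ly (Lh u)) (fun u v => etrans (Lh_sym u v) (dipC _ _ _ _))
  s a b ab_sympl dt phi Phi k PhiE.
(* Here the scalars form a module over themselves, and the form is the product x * y. *)
have q2E := @symplectic_rk_quadratic R R^o (fun x => x \*o idfun) (@mulrC R)
  s a b ab_sympl dt q Q l QE.
have -> : dissipation = 2^-1 * (dip Lx Ly (Lh phi') phi'
    - dip Lx Ly (Lh phi) phi) + (q' * q' - q * q).
  rewrite phiE qE LphiE q2E !mulrA mulVf ?pnatr_eq0// mul1r.
  rewrite [2 * dt]mulrC -mulrA -mulrDr; congr (_ * _).
  rewrite mulr_sumr -big_split /=; apply: eq_bigr => i _.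
  (* Stage by stage, (mu_i, k_i)_h = (L_h Phi_i, k_i)_h + 2 Q_i l_i. Dividing by the square root is
     legitimate because the radicand is positive at each stage. *)
  rewrite -kE dipDl dipZl lE dipZl; field.
  by rewrite gt_eqF // sqrtr_gt0.
by rewrite /discrete_energy; ring.
Qed.
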